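(* Let $p$ be a permutation and let $[p]=\{x : x \text{ is a Cayley permutation with } \mathfrak{st}(x)=p\}$. Let $\mathrm{Prim}[p]$ be the set of primitive modified ascent sequences that avoid every element of $[p]$, and let $\Omega(p)$ be the set of permutations in $\Omega$ that avoid $p$. Then standardization $\mathfrak{st}$ restricts to a length-preserving bijection from $\mathrm{Prim}[p]$ to $\Omega(p)$.
   Context: A Cayley permutation of length $n$ is a word $x=x_1\cdots x_n$ of positive integers whose set of values is $\{1,\dots,k\}$ for some $k\le n$; a permutation is a Cayley permutation with no repeated entries. A Cayley permutation $x$ contains a Cayley permutation $y=y_1\cdots y_k$ if there are indices $i_1<\cdots<i_k$ with $x_{i_s}<x_{i_t}\iff y_s<y_t$ and $x_{i_s}=x_{i_t}\iff y_s=y_t$ for all $s,t$; otherwise $x$ avoids $y$. The ascent tops of $x$ are the pairs $(1,x_1)$ and $(i,x_i)$ with $1<i\le n$ and $x_{i-1}<x_i$; the leftmost copies of $x$ are the pairs $(\min\{i:x_i=j\},j)$ for $1\le j\le\max(x)$. A modified ascent sequence is a Cayley permutation whose set of ascent tops equals its set of leftmost copies; it is primitive if it has no two consecutive equal entries. Standardization: if $x$ is a Cayley permutation and $a_i$ is the number of entries of $x$ equal to $i$, then $\mathfrak{st}(x)$ is the permutation obtained by replacing the $a_i$ copies of $i$, from left to right, by $a_1+\cdots+a_{i-1}+1,\dots,a_1+\cdots+a_{i-1}+a_i$. $\Omega$ is the set of permutations $p=p_1\cdots p_n$ (of any length $n\ge0$) such that either $n=0$ or $p_1=1$, and such that there are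 no indices $i,j$ with $i+1<j$, $p_i>p_{i+1}$ and $p_{i+1}=p_j+1$. *)

(* Defs.v *)
From mathcomp Require Import all_boot.
From mathcomp Require Import boolp classical_sets functions.
Set Implicit Arguments.
Unset Strict Implicit.
Unset Printing Implicit Defensive.

Local Open Scope classical_set_scope.

(* Words are sequences of naturals.  Positions are numbered from 0, so that
   x_i in the 1-based literature is nth 0 x i.-1; values are not shifted. *)

(* The bound k <= size x is automatic: 1, ..., k all occur in x. *)
Definition cayley_perm (x : seq nat) : Prop :=
  exists k : nat, forall v : nat, (v \in x) = (1 <= v <= k).

Definition is_permutation (p : seq nat) : Prop := cayley_perm p /\ uniq p.

(* s lists the increasing positions in x of an occurrence of y. *)
Definition contains (x y : seq nat) : Prop :=
  exists s : seq nat,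
    [/\ size s = size y,
        sorted ltn s,
        (forall i, i \in s -> i < size x) &
        forall a b, a < size y -> b < size y ->
          (nth 0 x (nth 0 s a) < nth 0 x (nth 0 s b)) = (nth 0 y a < nth 0 y b)
          /\
          (nth 0 x (nth 0 s a) == nth 0 x (nth 0 s b)) = (nth 0 y a == nth 0 y b)].

Definition avoids (x y : seq nat) : Prop := ~ contains x y.

Definition ascent_tops (x : seq nat) : seq (nat * nat) :=
  [seq (i, nth 0 x i) | i <- iota 0 (size x)
     & (i == 0) || (nth 0 x i.-1 < nth 0 x i)].

Definition leftmost_copies (x : seq nat) : seq (nat * nat) :=
  [seq (index j x, j) | j <- iota 1 (\max_(v <- x) v)].

Definition modified_ascent_seq (x : seq nat) : Prop :=
  cayley_perm x /\ ascent_tops x =i leftmost_copies x.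

Definition primitive (x : seq nat) : Prop :=
  forall i, i.+1 < size x -> nth 0 x i != nth 0 x i.+1.

(* The sum counts the entries smaller than x_i; the second term is the rank of
   position i, from the left and starting at 1, among the copies of x_i. *)
Definition standardization (x : seq nat) : seq nat :=
  mkseq (fun i =>
           \sum_(1 <= v < nth 0 x i) count_mem v x
           + count_mem (nth 0 x i) (take i.+1 x))
        (size x).

Definition fiber (p : seq nat) : set (seq nat) :=
  [set x | cayley_perm x /\ standardization x = p].

Definition Prim (p : seq nat) : set (seq nat) :=
  [set x | [/\ modified_ascent_seq x, primitive x &
               forall y, fiber p y -> avoids x y]].

Definition Omega : set (seq nat) :=
  [set p | [/\ is_permutation p,
               p = [::] \/ nth 0 p 0 = 1 &
               ~ exists i j, [/\ i.+1 < j, j < size p,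
                                 nth 0 p i > nth 0 p i.+1 &
                                 nth 0 p i.+1 = (nth 0 p j).+1]]].

Definition OmegaAv (p : seq nat) : set (seq nat) :=
  [set q | Omega q /\ avoids q p].

(* Main.v *)
Require Import Defs.
From mathcomp Require Import all_boot.
From mathcomp Require Import boolp classical_sets functions.
From mathcomp Require Import zify.

(** st(x) numbers the positions of x in the lexicographic order on pairs
    (x_i, i), and for a Cayley permutation x and a permutation p, st(x)
    contains p exactly when x contains some y with st(y) = p: read y off x
    along an occurrence of p in st(x).  Hence x avoids [p] iff st(x) avoids p,
    and it remains to see that st is a bijection from primitive modified ascent
    sequences to Omega.  If x is one of these, then x and st(x) have ascents at
    the same positions (no plateaus), and these are the positions of the
    leftmost copies; so x_i is the number of ascent tops of st(x) with value at
    most st(x)_i, which recovers x from st(x).  Applied to p in Omega, the same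
    formula gives a preimage: if p_j is not an ascent top, then the Omega
    condition puts the value p_j - 1 to the left of p_j, so positions sharing a
    value of x carry increasing values of p. *)

(** * Ranks in a list under a total order *)

(** Generic in [R], to serve for [leq] on values and [lexle] on positions. The element [a] may lie
    outside [T]: below, all entries of a word are ranked among its ascent tops. *)
Definition rank (R : rel nat) (T : seq nat) (a : nat) : nat := count (R^~ a) T.

Lemma rank_homo (R : rel nat) (T : seq nat) (a b : nat) :
  transitive R -> R a b -> rank R T a <= rank R T b.
Proof. by move=> Rtr Rab; apply: sub_count => c /= Rca; apply: Rtr Rab. Qed.

Lemma rank_ltn (R : rel nat) (T : seq nat) (a b : nat) :
  reflexive R -> transitive R -> b \in T -> R a b -> ~~ R b a ->
  rank R T a < rank R T b.
Proof.
move=> Rxx Rtr bT Rab nRba; rewrite /rank.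
have new : has (predI (R^~ b) (predC (R^~ a))) T.
  by apply/hasP; exists b => //=; rewrite Rxx.
move: new; rewrite has_count => new.
(* The elements below [b] split into those below [a] and the rest; the rest contains [b] itself. *)
have := count_predUI (R^~ a) (predI (R^~ b) (predC (R^~ a))) T.
rewrite (eq_count (a2 := R^~ b)); last first.
  move=> c /=; case Rca: (R c a) => /=; last by rewrite andbT.
  by rewrite (Rtr _ _ _ Rca Rab).
rewrite (eq_count (a1 := predI _ _) (a2 := pred0)); last first.
  by move=> c /=; case: (R c a); rewrite ?andbF.
by rewrite count_pred0; lia.
Qed.

Lemma leq_rank (R : rel nat) (T : seq nat) (a b : nat) :
  reflexive R -> transitive R -> total R -> a \in T ->
  (rank R T a <= rank R T b) = R a b.
Proof.
move=> Rxx Rtr Rtot aT; apply/idP/idP; last exact: rank_homo.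
apply: contraTT => nRab; rewrite -ltnNge rank_ltn //.
by case/orP: (Rtot a b) => // Rab; rewrite Rab in nRab.
Qed.

Lemma rank_inj (R : rel nat) (T : seq nat) :
  reflexive R -> transitive R -> antisymmetric R -> total R ->
  {in T &, injective (rank R T)}.
Proof.
move=> Rxx Rtr Ras Rtot a b aT bT eq_ab; apply: Ras.
by rewrite -!(leq_rank R T) ?eq_ab ?leqnn.
Qed.

(** Pigeonhole: the ranks are [size T] distinct numbers between 1 and [size T], so they fill this
    interval. *)
Lemma mem_ranks (R : rel nat) (T : seq nat) (v : nat) :
  reflexive R -> transitive R -> antisymmetric R -> total R -> uniq T ->
  (v \in [seq rank R T a | a <- T]) = (1 <= v <= size T).
Proof.
move=> Rxx Rtr Ras Rtot uT.
have uM : uniq [seq rank R T a | a <- T].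
  by rewrite map_inj_in_uniq //; apply: rank_inj.
have sM : {subset [seq rank R T a | a <- T] <= iota 1 (size T)}.
  move=> _ /mapP [a aT ->]; rewrite mem_iota add1n ltnS count_size andbT.
  by rewrite -has_count; apply/hasP; exists a.
have szM : size (iota 1 (size T)) <= size [seq rank R T a | a <- T].
  by rewrite size_iota size_map.
by have [_ ->] := uniq_min_size uM sM szM; rewrite mem_iota add1n ltnS.
Qed.

(** * Standardization as a rank among positions *)

(* The order of the positions of x in which standardization numbers them. *)
Definition lexle (x : seq nat) (i j : nat) : bool :=
  (nth 0 x i < nth 0 x j) || (nth 0 x i == nth 0 x j) && (i <= j).

Lemma lexle_refl (x : seq nat) : reflexive (lexle x).
Proof. by move=> i; rewrite /lexle eqxx leqnn orbT. Qed.

Lemma lexle_trans (x : seq nat) : transitive (lexle x).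
Proof. by move=> j i k; rewrite /lexle; lia. Qed.

Lemma lexle_anti (x : seq nat) : antisymmetric (lexle x).
Proof. by move=> i j; rewrite /lexle; lia. Qed.

Lemma lexle_total (x : seq nat) : total (lexle x).
Proof. by move=> i j; rewrite /lexle; lia. Qed.

Lemma count_iota_nth (f : pred nat) (s : seq nat) :
  count f s = count (fun j => f (nth 0 s j)) (iota 0 (size s)).
Proof. by rewrite -{1}(mkseq_nth 0 s) count_map. Qed.

(** Positivity matters because the sum starts at [v = 1]: each entry below [c] is then counted once,
    at its own value. *)
Lemma sum_count_mem (x : seq nat) (c : nat) :
  all (leq 1) x -> \sum_(1 <= v < c) count_mem v x = count (fun u => u < c) x.
Proof.
elim: x => [|u x IHx] /=; first by rewrite big1.
case/andP=> u1 /IHx <-; rewrite big_split /=; congr (_ + _).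
under eq_bigr do rewrite eq_sym.
case: (ltnP u c) => [uc|cu].
  rewrite (bigD1_seq u) ?iota_uniq ?mem_index_iota ?u1 //= eqxx big1 // => v.
  by move/negbTE->.
by rewrite big_nat big1 // => v /andP [_ vc]; case: eqP => // ?; lia.
Qed.

Lemma count_take (f : pred nat) (x : seq nat) (i : nat) : i < size x ->
  count f (take i.+1 x)
  = count (fun j => f (nth 0 x j) && (j <= i)) (iota 0 (size x)).
Proof.
move=> ix; rewrite count_iota_nth size_takel //.
rewrite -[in RHS](subnKC ix) iotaD count_cat add0n.
rewrite [X in _ + X](eq_in_count (a2 := pred0)); last first.
  by move=> j; rewrite mem_iota /= => /andP [ij _]; rewrite leqNgt ij andbF.
rewrite count_pred0 addn0; apply: eq_in_count => j; rewrite mem_iota /= ltnS.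
by move=> ji; rewrite nth_take // ji andbT.
Qed.

Lemma cayley_pos (x : seq nat) : cayley_perm x -> all (leq 1) x.
Proof. by case=> k xk; apply/allP => v; rewrite xk => /andP []. Qed.

Lemma size_standardization (x : seq nat) : size (standardization x) = size x.
Proof. by rewrite size_mkseq. Qed.

(** The two terms count disjoint sets of positions, those with a smaller value and those up to [i]
    with an equal one; their union is the set of positions below [i] for [lexle x]. *)
Lemma standardizationE (x : seq nat) : cayley_perm x ->
  standardization x
  = [seq rank (lexle x) (iota 0 (size x)) i | i <- iota 0 (size x)].
Proof.
move=> /cayley_pos x1; apply/eq_in_map => i; rewrite mem_iota /= => ix.
rewrite sum_count_mem // count_take // count_iota_nth /rank -count_predUI.
rewrite [X in _ + X](eq_count (a2 := pred0)) ?count_pred0 ?addn0.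
  by apply: eq_count.
by move=> j /=; case: ltngtP.
Qed.

Lemma standardization_perm (x : seq nat) :
  cayley_perm x -> is_permutation (standardization x).
Proof.
move=> cx; rewrite standardizationE //; split.
  exists (size (iota 0 (size x))) => v; apply: mem_ranks; rewrite ?iota_uniq //.
  - exact: lexle_refl.
  - exact: lexle_trans.
  - exact: lexle_anti.
  - exact: lexle_total.
rewrite map_inj_in_uniq ?iota_uniq //; apply: rank_inj.
- exact: lexle_refl.
- exact: lexle_trans.
- exact: lexle_anti.
- exact: lexle_total.
Qed.

Lemma leq_standardization (x : seq nat) (i j : nat) :
  cayley_perm x -> i < size x -> j < size x ->
  (nth 0 (standardization x) i <= nth 0 (standardization x) j) = lexle x i j.
Proof.
move=> cx ix jx; rewrite standardizationE //.
rewrite !(nth_map 0) ?size_iota // !nth_iota // leq_rank ?mem_iota //.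
- exact: lexle_refl.
- exact: lexle_trans.
- exact: lexle_total.
Qed.

(** * Permutations are determined by their relative order *)

Lemma perm_iota (p : seq nat) :
  is_permutation p -> perm_eq p (iota 1 (size p)).
Proof.
case=> [[k pk] up].
have eq_p : p =i iota 1 k by move=> v; rewrite pk mem_iota add1n ltnS.
have pp : perm_eq p (iota 1 k) by apply: uniq_perm; rewrite ?iota_uniq.
by have := perm_size pp; rewrite size_iota => ->.
Qed.

Lemma mem_permutation (p : seq nat) (v : nat) :
  is_permutation p -> (v \in p) = (1 <= v <= size p).
Proof. by move/perm_iota/perm_mem->; rewrite mem_iota add1n ltnS. Qed.

Lemma count_iota_leq (v n : nat) : v <= n -> count (leq^~ v) (iota 1 n) = v.
Proof.
move=> vn; rewrite -(subnKC vn) iotaD count_cat.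
rewrite (eq_in_count (a2 := predT)) ?count_predT ?size_iota; last first.
  by move=> u; rewrite mem_iota /=; lia.
rewrite (eq_in_count (a2 := pred0)) ?count_pred0 ?addn0 //.
by move=> u; rewrite mem_iota /=; lia.
Qed.

Lemma permutation_nthE (p : seq nat) (i : nat) :
  is_permutation p -> i < size p ->
  nth 0 p i = count (fun j => nth 0 p j <= nth 0 p i) (iota 0 (size p)).
Proof.
move=> pp ip; rewrite -(count_iota_nth (leq^~ (nth 0 p i))).
rewrite (permP (perm_iota p pp)) count_iota_leq //.
by have := mem_nth 0 ip; rewrite mem_permutation // => /andP [].
Qed.

Lemma eq_permutation (p q : seq nat) :
  is_permutation p -> is_permutation q -> size p = size q ->
  (forall i j, i < size p -> j < size p ->
     (nth 0 p i <= nth 0 p j) = (nth 0 q i <= nth 0 q j)) ->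
  p = q.
Proof.
move=> pp pq eq_sz eq_le; apply: (@eq_from_nth _ 0) => // i ip.
rewrite permutation_nthE // [RHS]permutation_nthE -?eq_sz //.
by apply: eq_in_count => j; rewrite mem_iota /= => jp; apply: eq_le.
Qed.

(** * Pattern containment and standardization *)

(** Since [a] and [b] range over all pairs, weak comparisons give the strict ones by negation and
    the equalities by antisymmetry. *)
Lemma containsE (x y : seq nat) :
  contains x y <->
  exists s : seq nat,
    [/\ size s = size y, sorted ltn s, (forall i, i \in s -> i < size x) &
        forall a b, a < size y -> b < size y ->
          (nth 0 x (nth 0 s a) <= nth 0 x (nth 0 s b)) =
          (nth 0 y a <= nth 0 y b)].
Proof.
split=> -[s [szs ss sx sP]]; exists s; split=> // a b ay by_.
  by have [h _] := sP b a by_ ay; rewrite leqNgt h -leqNgt.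
by split; rewrite ?eqn_leq ?ltnNge !sP.
Qed.

Lemma sorted_leq_nth (s : seq nat) (a b : nat) :
  sorted ltn s -> a < size s -> b < size s ->
  (nth 0 s a <= nth 0 s b) = (a <= b).
Proof.
by move=> ss al bl; apply: (leq_mono_in (sorted_ltn_nth ltn_trans 0 ss)).
Qed.

(** The Cayley permutation order-isomorphic to [w]; [undup] makes the ranks count distinct values,
    so that none is skipped. *)
Definition flatten_word (w : seq nat) : seq nat :=
  [seq rank leq (undup w) v | v <- w].

Lemma flatten_word_cayley (w : seq nat) : cayley_perm (flatten_word w).
Proof.
exists (size (undup w)) => v; rewrite -(mem_ranks leq) ?undup_uniq //.
- by apply: eq_mem_map => u; rewrite mem_undup.
- exact: leq_trans.
- exact: anti_leq.
- exact: leq_total.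
Qed.

Lemma leq_flatten_word (w : seq nat) (a b : nat) :
  a < size w -> b < size w ->
  (nth 0 (flatten_word w) a <= nth 0 (flatten_word w) b) =
  (nth 0 w a <= nth 0 w b).
Proof.
move=> aw bw; rewrite !(nth_map 0) // leq_rank ?mem_undup ?mem_nth //.
- exact: leq_trans.
- exact: leq_total.
Qed.

Lemma lexleE (x : seq nat) (i j : nat) :
  lexle x i j = (nth 0 x i <= nth 0 x j) &&
                ((nth 0 x j <= nth 0 x i) ==> (i <= j)).
Proof. by rewrite /lexle; lia. Qed.

(** An occurrence preserves comparisons of values, and an increasing [s] preserves the order of
    positions that breaks ties. *)
Lemma lexle_subword (x y s : seq nat) (a b : nat) :
  size s = size y -> sorted ltn s ->
  (forall c d, c < size y -> d < size y ->
     (nth 0 x (nth 0 s c) <= nth 0 x (nth 0 s d)) =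
     (nth 0 y c <= nth 0 y d)) ->
  a < size y -> b < size y ->
  lexle x (nth 0 s a) (nth 0 s b) = lexle y a b.
Proof.
by move=> szs ss sP ay by_; rewrite !lexleE !sP // (sorted_leq_nth s) ?szs.
Qed.

Lemma contains_standardization (x p : seq nat) :
  cayley_perm x -> is_permutation p ->
  contains (standardization x) p <-> exists2 y, fiber p y & contains x y.
Proof.
move=> cx pp; split.
  case/containsE=> s [szs ss sx sP]; rewrite size_standardization in sx.
  pose y := flatten_word [seq nth 0 x i | i <- s].
  have szy : size y = size s by rewrite !size_map.
  have cy : cayley_perm y := flatten_word_cayley _.
  have yP c d : c < size y -> d < size y ->
      (nth 0 x (nth 0 s c) <= nth 0 x (nth 0 s d)) = (nth 0 y c <= nth 0 y d).
    rewrite szy => cs ds.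
    by rewrite leq_flatten_word ?size_map // !(nth_map 0).
  exists y; last by apply/containsE; exists s.
  split=> //; apply: eq_permutation => //.
  - exact: standardization_perm.
  - by rewrite size_standardization szy.
  rewrite size_standardization => i j iy jy.
  rewrite leq_standardization // -(lexle_subword x y s) // -sP -?szs -?szy //.
  by rewrite leq_standardization // sx // mem_nth -?szy.
case=> y [cy <-] /containsE [s [szs ss sx sP]]; apply/containsE; exists s.
rewrite !size_standardization; split=> // a b ay by_.
have sx' c : c < size y -> nth 0 s c < size x.
  by move=> cy'; rewrite sx // mem_nth ?szs.
by rewrite !leq_standardization ?sx' // (lexle_subword x y s).
Qed.

(** * Ascent tops and leftmost copies, position by position *)

Definition asc (x : seq nat) (i : nat) : bool :=
  (i == 0) || (nth 0 x i.-1 < nth 0 x i).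

Lemma mem_ascent_tops (x : seq nat) (i v : nat) :
  ((i, v) \in ascent_tops x) = [&& i < size x, v == nth 0 x i & asc x i].
Proof.
apply/mapP/and3P => [[j]|[ix /eqP -> ai]].
  by rewrite mem_filter mem_iota /= => /andP [aj jx] [-> ->].
by exists i => //; rewrite mem_filter mem_iota /= ix andbT.
Qed.

Lemma mem_leftmost_copies (x : seq nat) (i v : nat) : cayley_perm x ->
  ((i, v) \in leftmost_copies x) =
  [&& i < size x, v == nth 0 x i & index (nth 0 x i) x == i].
Proof.
case=> k xk; have maxx : \max_(u <- x) u = k.
  apply/eqP; rewrite eqn_leq; apply/andP; split.
    by apply/bigmax_leqP_seq => u; rewrite xk => /andP [].
  (* For [k = 0] the bound is trivial; otherwise the value [k.+1] occurs in [x]. *)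
  case: k xk => // k xk; rewrite (big_rem k.+1) ?leq_maxl //.
  by rewrite xk /=.
apply/mapP/and3P => [[u]|[ix /eqP -> /eqP ei]].
  rewrite maxx mem_iota add1n ltnS -xk => ux [-> ->].
  by rewrite index_mem nth_index ?eqxx.
exists (nth 0 x i); last by rewrite ei.
by rewrite maxx mem_iota add1n ltnS -xk mem_nth.
Qed.

Lemma modified_ascentP (x : seq nat) : cayley_perm x ->
  ascent_tops x =i leftmost_copies x <->
  (forall i, i < size x -> asc x i = (index (nth 0 x i) x == i)).
Proof.
move=> cx; split=> [eqx i ix|eqx [i v]].
  have := eqx (i, nth 0 x i).
  by rewrite mem_ascent_tops mem_leftmost_copies // ix eqxx.
rewrite mem_ascent_tops mem_leftmost_copies //.
by case: ltnP => //= ix; rewrite eqx.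
Qed.

Lemma index_nth_leq (x : seq nat) (i : nat) : index (nth 0 x i) x <= i.
Proof.
case: (ltnP i (size x)) => [ix|xi]; last exact: leq_trans (index_size _ _) xi.
by rewrite leqNgt; apply/negP => /(before_find 0) /=; rewrite eqxx.
Qed.

(** * Recovering a word from its standardization *)

Definition asc_values (p : seq nat) : seq nat :=
  [seq nth 0 p i | i <- iota 0 (size p) & asc p i].

Definition unstandardization (p : seq nat) : seq nat :=
  [seq rank leq (asc_values p) v | v <- p].

Lemma nth_unstandardization (p : seq nat) (i : nat) : i < size p ->
  nth 0 (unstandardization p) i =
  count (fun j => asc p j && (nth 0 p j <= nth 0 p i)) (iota 0 (size p)).
Proof.
move=> ip; rewrite (nth_map 0) // /rank count_map count_filter.
by apply: eq_count => j /=; rewrite andbC.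
Qed.

(** Ties are numbered from left to right, so a plateau of [x] would become an ascent; primitivity
    excludes plateaus. *)
Lemma asc_standardization (x : seq nat) (i : nat) :
  cayley_perm x -> primitive x -> i < size x ->
  asc (standardization x) i = asc x i.
Proof.
move=> cx px; case: i => // i ix; rewrite /asc /=.
rewrite ltnNge leq_standardization //; last exact: ltnW.
by have := px i ix; rewrite /lexle; lia.
Qed.

(** The map [index^~ x] sends the values from 1 to [nth 0 x i] bijectively onto the leftmost copies
    counted on the right. *)
Lemma cayley_nthE (x : seq nat) (i : nat) : cayley_perm x -> i < size x ->
  nth 0 x i =
  count (fun j => (index (nth 0 x j) x == j) && (nth 0 x j <= nth 0 x i))
    (iota 0 (size x)).
Proof.
case=> k xk ix; rewrite -size_filter -[LHS](size_iota 1).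
rewrite -(size_map (index^~ x)); apply/perm_size/uniq_perm.
- rewrite map_inj_in_uniq ?iota_uniq // => u v.
  have := mem_nth 0 ix; rewrite xk !mem_iota => xik ui vi eq_uv.
  by move/(congr1 (nth 0 x)): eq_uv; rewrite !nth_index // xk; simpl in *; lia.
- by rewrite filter_uniq ?iota_uniq.
have := mem_nth 0 ix; rewrite xk => xik j.
apply/mapP/idP => [[u]|].
  rewrite mem_iota => ui ->; have ux : u \in x by rewrite xk; simpl in *; lia.
  by rewrite mem_filter mem_iota nth_index // index_mem ux eqxx; lia.
rewrite mem_filter mem_iota /= => /andP [/andP [/eqP ej lej] jx].
exists (nth 0 x j) => //; rewrite mem_iota add1n ltnS lej andbT.
by have := mem_nth 0 jx; rewrite xk => /andP [].
Qed.

Lemma standardizationK (x : seq nat) :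
  modified_ascent_seq x -> primitive x ->
  unstandardization (standardization x) = x.
Proof.
case=> cx /(modified_ascentP x cx) mx px.
apply: (@eq_from_nth _ 0); first by rewrite size_map size_standardization.
rewrite size_map size_standardization => i ix.
rewrite nth_unstandardization ?size_standardization // [RHS]cayley_nthE //.
apply: eq_in_count => j; rewrite mem_iota /= => jx.
rewrite asc_standardization // leq_standardization // mx //.
(* If [j] and [i] carry the same value, then [j <= i] because [j] is its leftmost copy. *)
case: eqP => //= ej; rewrite /lexle; have := index_nth_leq x i.
by case: ltngtP => //= <-; rewrite ej.
Qed.

(** * Standardizations lie in [Omega] *)

(** The leftmost 1 is an ascent top; at a later position it would be preceded by an entry 0. *)
Lemma head_modified_ascent (x : seq nat) :
  modified_ascent_seq x -> 0 < size x -> nth 0 x 0 = 1.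
Proof.
case=> cx /(modified_ascentP x cx) mx x0; have [k xk] := cx.
have x1 : 1 \in x.
  rewrite xk /=; have := mem_nth 0 x0; rewrite xk => /andP [].
  exact: leq_trans.
have := mx (index 1 x); rewrite index_mem x1 nth_index // eqxx /asc.
move/(_ isT); case: eqP => [e _|_].
  by have := nth_index 0 x1; rewrite e.
move=> /=; rewrite nth_index // ltnS leqn0 => /eqP x0'.
have lt : (index 1 x).-1 < size x.
  by apply: leq_ltn_trans (leq_pred _) _; rewrite index_mem.
by have /allP := cayley_pos x cx => /(_ _ (mem_nth 0 lt)); rewrite x0'.
Qed.

Lemma Omega_standardization (x : seq nat) :
  modified_ascent_seq x -> primitive x -> Omega (standardization x).
Proof.
move=> mx px; have x1 := head_modified_ascent x mx.
case: mx => cx /(modified_ascentP x cx) mx.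
have pp := standardization_perm x cx; split=> //.
  case: (posnP (size x)) => [/size0nil ->|x0]; first by left.
  (* Only position 0 is weakly below position 0: all other entries are at least 1, and position 0
     wins ties. *)
  right; rewrite permutation_nthE // size_standardization //.
  rewrite -[RHS](size_iota 0) -[iota 0 1]/[:: 0] /=.
  rewrite -(prednK x0) /= leqnn (eq_in_count (a2 := pred0)) ?count_pred0 //.
  move=> j; rewrite mem_iota /= => jx.
  rewrite leq_standardization //; last lia.
  have jx' : j < size x by lia.
  have /allP := cayley_pos x cx => /(_ _ (mem_nth 0 jx')).
  by rewrite /lexle x1 //=; simpl in *; lia.
case=> i [j []]; rewrite size_standardization => ij jx gt_i e.
have i1x : i.+1 < size x by lia.
have nas : asc x i.+1 = false.
  by rewrite -asc_standardization // /asc /=; lia.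
(* An earlier copy [l] of the same value would satisfy [l <= j < i.+1] in the order [lexle x], so
   [j] would carry this value too, while lying to the right of [i.+1]. *)
have left : index (nth 0 x i.+1) x == i.+1.
  rewrite eqn_leq index_nth_leq /= leqNgt; apply/negP => lt.
  set l := index _ x in lt.
  have lx : l < size x by lia.
  have xl : nth 0 x l = nth 0 x i.+1 by rewrite nth_index // mem_nth.
  have : nth 0 (standardization x) l < nth 0 (standardization x) i.+1.
    by rewrite ltnNge leq_standardization // /lexle xl; lia.
  rewrite e ltnS leq_standardization // => lj.
  have : nth 0 (standardization x) j < nth 0 (standardization x) i.+1.
    by rewrite e.
  by rewrite ltnNge leq_standardization //; move: lj; rewrite /lexle xl; lia.
by rewrite -mx // nas in left.
Qed.

(** * The inverse map on [Omega] *)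

Section Unstandardization.

Variable p : seq nat.
Hypothesis Op : Omega p.

Let x := unstandardization p.

Let pp : is_permutation p. Proof. by case: Op. Qed.

Let szx : size x = size p. Proof. exact: size_map. Qed.

Let nthx i : i < size p -> nth 0 x i = rank leq (asc_values p) (nth 0 p i).
Proof. by move=> ip; rewrite (nth_map 0). Qed.

Let mem_asc_values i : i < size p -> asc p i -> nth 0 p i \in asc_values p.
Proof.
by move=> ip ai; apply: map_f; rewrite mem_filter ai mem_iota.
Qed.

Let nth_inj i j : i < size p -> j < size p -> nth 0 p i = nth 0 p j -> i = j.
Proof.
by move=> ip jp /eqP; rewrite nth_uniq //; [move/eqP | case: pp].
Qed.

Lemma unstandardization_homo (i j : nat) : i < size p -> j < size p ->
  nth 0 p i <= nth 0 p j -> nth 0 x i <= nth 0 x j.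
Proof.
by move=> ip jp le; rewrite !nthx // rank_homo //; apply: leq_trans.
Qed.

(** The value at the ascent top [j] is counted in its own rank but not in that of the smaller value
    at [i]. *)
Lemma unstandardization_asc_ltn (i j : nat) : i < size p -> j < size p ->
  nth 0 p i < nth 0 p j -> asc p j -> nth 0 x i < nth 0 x j.
Proof.
move=> ip jp lt aj; rewrite !nthx //; apply: rank_ltn.
- exact: leqnn.
- exact: leq_trans.
- exact: mem_asc_values.
- exact: ltnW.
- by rewrite -ltnNge.
Qed.

Lemma pred_position (j : nat) : j < size p -> 1 < nth 0 p j ->
  exists2 i, i < size p & nth 0 p j = (nth 0 p i).+1.
Proof.
move=> jp gt1; have ip : (nth 0 p j).-1 \in p.
  have := mem_nth 0 jp; rewrite !mem_permutation // => /andP [_ le].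
  by rewrite -ltnS prednK ?gt1 ?(leq_trans (leq_pred _)) // ltnW.
exists (index (nth 0 p j).-1 p); rewrite ?index_mem // nth_index //.
by rewrite prednK // ltnW.
Qed.

(** A non-ascent [j] is the bottom of a descent; if [i] were to its right, this descent and [i]
    would form the pattern forbidden in [Omega]. *)
Lemma Omega_step (i j : nat) : i < size p -> j < size p ->
  nth 0 p j = (nth 0 p i).+1 -> ~~ asc p j -> i < j.
Proof.
case: j => [|j] // ip jp e; rewrite /asc /= -leqNgt => le.
have neq : nth 0 p j != nth 0 p j.+1.
  by apply/eqP => /nth_inj; lia.
case: Op => _ _ no; rewrite ltnNge; apply/negP => ji; apply: no.
exists j, i; split=> //.
  by rewrite ltn_neqAle ji andbT; case: eqP e => // ->; lia.
by rewrite ltn_neqAle eq_sym neq.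
Qed.

Lemma unstandardization_eq_ltn (i j : nat) : i < size p -> j < size p ->
  nth 0 p i < nth 0 p j -> nth 0 x i = nth 0 x j -> i < j.
Proof.
(* Induction on the gap between the two values of [p]: descend from [j] to the position [a] of the
   preceding value, which lies to the left of [j]. *)
move=> ip + + eq_x; have [d] := ubnP (nth 0 p j - nth 0 p i).
elim: d j eq_x => // d IHd j eq_x led jp lt.
have naj : ~~ asc p j.
  by apply/negP => /(unstandardization_asc_ltn i j ip jp lt); rewrite eq_x ltnn.
have pi1 : 0 < nth 0 p i.
  by have := mem_nth 0 ip; rewrite mem_permutation // => /andP [].
have [|a ap e] := pred_position j jp; first by lia.
have aj := Omega_step a j ap jp e naj.
case: (eqVneq (nth 0 p i) (nth 0 p a)) => [/nth_inj -> //|ne].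
have lt_ia : nth 0 p i < nth 0 p a by lia.
apply: ltn_trans aj; apply: IHd => //; last by lia.
(* By monotonicity [nth 0 x a] is squeezed between the equal entries at [i] and [j]. *)
by apply/eqP; rewrite eqn_leq {2}eq_x !unstandardization_homo //; lia.
Qed.

Lemma lexle_unstandardization (i j : nat) : i < size p -> j < size p ->
  lexle x i j = (nth 0 p i <= nth 0 p j).
Proof.
have aux a b : a < size p -> b < size p ->
    nth 0 p a <= nth 0 p b -> lexle x a b.
  move=> ap bp; rewrite leq_eqVlt => /orP [/eqP /nth_inj -> //|lt].
    exact: lexle_refl.
  have := unstandardization_homo a b ap bp (ltnW lt).
  have := unstandardization_eq_ltn a b ap bp lt.
  rewrite /lexle; case: (ltngtP (nth 0 x a) (nth 0 x b)) => //= e.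
  by move/(_ e)/ltnW.
move=> ip jp; apply/idP/idP; last exact: aux.
case: (leqP (nth 0 p i) (nth 0 p j)) => // lt le_ij.
have ij : i = j by apply: (lexle_anti x); rewrite le_ij aux // ltnW.
by rewrite ij ltnn in lt.
Qed.

(** The position [i] serves as a witness that [p] is nonempty. *)
Lemma head_Omega (i : nat) : i < size p -> nth 0 p 0 = 1.
Proof. by case: Op => _ [->|]. Qed.

Lemma unstandardization_cayley : cayley_perm x.
Proof.
have uT : uniq (asc_values p).
  rewrite map_inj_in_uniq ?filter_uniq ?iota_uniq // => i j.
  rewrite !mem_filter !mem_iota /= => /andP [_ ip] /andP [_ jp].
  exact: nth_inj.
exists (size (asc_values p)) => v; rewrite -(mem_ranks leq) //.
- apply/idP/idP => [/mapP [u up ->]|/mapP [u + ->]]; last first.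
    case/mapP => i; rewrite mem_filter mem_iota /= => /andP [_ ip] ->.
    by apply: map_f; apply: mem_nth.
  rewrite mem_ranks ?uT ?count_size ?andbT //; first last.
  - exact: leq_total.
  - exact: anti_leq.
  - exact: leq_trans.
  have p0 : 0 < size p by case: (p) up.
  (* Ranks are positive: the first entry 1 is an ascent top below every entry. *)
  rewrite -has_count; apply/hasP; exists (nth 0 p 0).
    exact: mem_asc_values.
  rewrite (head_Omega 0 p0); move: up.
  by rewrite mem_permutation // => /andP [].
- exact: leq_trans.
- exact: anti_leq.
- exact: leq_total.
Qed.

Lemma unstandardizationK : standardization x = p.
Proof.
have cx := unstandardization_cayley.
apply: eq_permutation => //; first exact: standardization_perm.
  by rewrite size_standardization.
rewrite size_standardization szx => i j ip jp.
by rewrite leq_standardization ?szx // lexle_unstandardization.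
Qed.

Lemma asc_unstandardization (i : nat) : i < size p -> asc x i = asc p i.
Proof.
case: i => // i ip; rewrite /asc /=; apply/idP/idP => [|lt].
  rewrite ltnNge; apply: contraNT; rewrite -leqNgt.
  by apply: unstandardization_homo => //; apply: ltnW.
by apply: unstandardization_asc_ltn => //; rewrite 1?ltnW.
Qed.

(** On a plateau of [x], the tie-break would force an ascent of [p], where [x] increases
    strictly. *)
Lemma primitive_unstandardization : primitive x.
Proof.
move=> i; rewrite szx => ip; apply/eqP => e.
have := lexle_unstandardization i i.+1 (ltnW ip) ip.
rewrite /lexle e eqxx leqnSn orbT => /esym le.
have ne : nth 0 p i != nth 0 p i.+1.
  by apply/eqP => /nth_inj; have := ltnW ip; lia.
have : asc x i.+1.
  by rewrite asc_unstandardization // /asc /= ltn_neqAle ne.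
by rewrite /asc /= e ltnn.
Qed.

Lemma modified_ascent_unstandardization : modified_ascent_seq x.
Proof.
have cx := unstandardization_cayley; split=> //; apply/(modified_ascentP x cx).
rewrite szx => i ip; rewrite asc_unstandardization //; apply/idP/idP => [ai|].
  set l := index _ x.
  have li : l <= i := index_nth_leq x i.
  have lp : l < size p := leq_ltn_trans li ip.
  have xl : nth 0 x l = nth 0 x i by rewrite nth_index // mem_nth // szx.
  (* The leftmost copy [l] of the value at an ascent top [i] cannot have a smaller value in [p], so
     the tie-break gives [i <= l]. *)
  have : ~~ (nth 0 p l < nth 0 p i).
    apply/negP => /(unstandardization_asc_ltn l i lp ip)/(_ ai).
    by rewrite xl ltnn.
  rewrite -leqNgt -lexle_unstandardization // /lexle xl; lia.
apply: contraTT => nai.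
have i0 : 0 < i by case: i ip nai.
have gt1 : 1 < nth 0 p i.
  have := mem_nth 0 ip; rewrite mem_permutation // => /andP [pi1 _].
  rewrite ltn_neqAle pi1 andbT -(head_Omega i ip); apply/eqP => /nth_inj.
  by lia.
have [a ap e] := pred_position i ip gt1.
have ai := Omega_step a i ap ip e nai.
(* It remains to see that [a], which lies to the left of [i], carries the same value of [x]: raising
   the bound from [nth 0 p a] to [nth 0 p i] only adds position [i], not an ascent top. *)
suff <- : nth 0 x a = nth 0 x i by have := index_nth_leq x a; lia.
rewrite !nth_unstandardization //; apply: eq_in_count => j.
rewrite mem_iota /= => jp; rewrite [in RHS]e [in RHS]leq_eqVlt ltnS.
case: eqP => //= ej; rewrite -e in ej.
by rewrite (nth_inj _ _ jp ip ej) (negbTE nai).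
Qed.

End Unstandardization.

(** * The bijection and its compatibility with avoidance *)

Theorem theorem3p8 (p : seq nat) (hp : is_permutation p) :
  set_bij (Prim p) (OmegaAv p) standardization /\
  (forall x : seq nat, Prim p x -> size (standardization x) = size x).
Proof.
have avoidE x : cayley_perm x ->
    (forall y, fiber p y -> avoids x y) <-> avoids (standardization x) p.
  move=> cx; split=> [av|av y py xy].
    by case/(contains_standardization x p cx hp) => y /av.
  by apply: av; apply/contains_standardization => //; exists y.
split; last by move=> x _; apply: size_standardization.
split.
- move=> x [mx px av]; split; first exact: Omega_standardization.
  by apply/avoidE => //; case: mx.
- move=> x y /set_mem [mx px _] /set_mem [my py _] e.
  by rewrite -(standardizationK x) // e standardizationK.
- move=> q [Oq avq]; exists (unstandardization q);
    last exact: unstandardizationK.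
  split.
  + exact: modified_ascent_unstandardization.
  + exact: primitive_unstandardization.
  + apply/avoidE; last by rewrite unstandardizationK.
    exact: unstandardization_cayley.
Qed.
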